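(* Let $X$ be a subset of $\mathbb{Q}$. Then there is an idempotent endomorphism of $(\mathbb{Q},\leqslant)$ with image equal to $X$ if and only if no maximal interval within $\mathbb{Q}\setminus X$ is closed in the topology on $\mathbb{Q}$ induced from the Euclidean topology on $\mathbb{R}$.
   Context: An endomorphism of $(\mathbb{Q},\leqslant)$ is a map $f\colon\mathbb{Q}\to\mathbb{Q}$ such that $u\leqslant v$ implies $uf\leqslant vf$ (maps are written on the right); it is idempotent if $f^2=f$. For a subset $A\subseteq\mathbb{Q}$, define a symmetric relation $\sim$ on $A$ as follows: for $a,b\in A$ with $a\leqslant b$, put $a\sim b$ if $c\in A$ for all $c\in\mathbb{Q}$ satisfying $a\leqslant c\leqslant b$. This is an equivalence relation on $A$; its equivalence classes are called the maximal intervals of $A$ (or within $A$). *)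

(* Defs.v *)
From mathcomp Require Import all_boot all_order all_algebra.
From mathcomp Require Import all_classical all_reals all_analysis.
Import Order.TTheory GRing.Theory Num.Theory.
Import numFieldNormedType.Exports.

Set Implicit Arguments.
Unset Strict Implicit.
Unset Printing Implicit Defensive.

Local Open Scope classical_set_scope.
Local Open Scope ring_scope.

Definition same_interval (A : set rat) (a b : rat) : Prop :=
  [/\ A a, A b &
      (a <= b /\ forall c : rat, a <= c <= b -> A c) \/
      (b <= a /\ forall c : rat, b <= c <= a -> A c)].

Definition maximal_interval (A I : set rat) : Prop :=
  exists2 a : rat, A a & I = [set b | same_interval A a b].

Definition closed_in_rat (R : realType) (I : set rat) : Prop :=
  @closed (initial_topology (ratr : rat -> R)) I.

(* Main.v *)
Require Import Defs.
From mathcomp Require Import all_boot all_order all_algebra.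
From mathcomp Require Import all_classical all_reals all_analysis.
From mathcomp Require Import lra.
Import Order.TTheory GRing.Theory Num.Theory.
Import numFieldNormedType.Exports.

Set Implicit Arguments.
Unset Strict Implicit.
Unset Printing Implicit Defensive.

Local Open Scope classical_set_scope.
Local Open Scope ring_scope.

(** The interval [I] of [a] in [~` X] fails to be closed exactly when some
    rational [y] in [X] is an endpoint of it, i.e. no point of [X] lies strictly
    between [a] and [y].  If [f] is an idempotent endomorphism with image [X],
    then [y = f a] is such an endpoint, because [f] fixes [X] pointwise.
    Conversely, fixing [X] and sending each interval to one of its endpoints in
    [X] is monotone, since two points in different intervals are separated by a
    point of [X]. *)

Definition adjacent (X : set rat) (a y : rat) : Prop :=
  X y /\ forall z, X z -> ~ (a < z < y) /\ ~ (y < z < a).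

(** Letting [c] be an endpoint recovers [A a] and [A b]; the form symmetric in [a] and [b] spares
    case splits on their order. *)
Lemma same_intervalP (A : set rat) (a b : rat) :
  same_interval A a b <-> forall c, a <= c <= b \/ b <= c <= a -> A c.
Proof.
split=> [[_ _ [[ab h]|[ba h]]] c [hc|hc]|h].
- exact: h.
- by apply: h; lra.
- by apply: h; lra.
- exact: h.
- by split; [apply: h; lra|apply: h; lra|]; have [ab|ba] := leP a b;
    [left|right]; split=> [|c hc]; [|apply: h; lra|lra|apply: h; lra].
Qed.

Lemma same_interval_sym (A : set rat) (a b : rat) :
  same_interval A a b -> same_interval A b a.
Proof.
move=> /same_intervalP h; apply/same_intervalP => c hc; apply: h; tauto.
Qed.

(** No point of [X] lies in the hull of [a] and [b], so a [z] in [X] strictly between [b] and [y]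
    would also be strictly between [a] and [y]. *)
Lemma adjacent_same_interval (X : set rat) (a b : rat) :
  same_interval (~` X) a b -> adjacent X a `<=` adjacent X b.
Proof.
move=> /same_intervalP sab y [Xy ady]; split=> // z Xz.
have [n1 n2] := ady _ Xz.
have nz : ~ (a <= z <= b \/ b <= z <= a) by move=> /sab.
have ny : ~ (a <= y <= b \/ b <= y <= a) by move=> /sab.
by split=> hz; have [?|?|?] := ltgtP z a; have [?|?|?] := ltgtP y a; lra.
Qed.

(** [ratr] preserves distances and every positive real exceeds a positive rational, so balls of
    rational radius suffice. *)
Lemma closed_in_ratP (R : realType) (I : set rat) :
  closed_in_rat R I <->
  forall y : rat,
    (forall e : rat, 0 < e -> exists2 c, I c & `|y - c| < e) -> I y.
Proof.
split=> clI y Iy; apply: clI.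
- move=> B [_ [[V Vo <-] /= Vy] VB].
  have /nbhs_ballP[e /= e0 eV] : nbhs (ratr y : R) V by exact: open_nbhs_nbhs.
  have [q] := rat_in_itvoo e0; rewrite in_itv/= ltr0q => /andP[q0 qe].
  have [c Ic yc] := Iy _ q0; exists c; split=> //; apply/VB/eV.
  rewrite /ball/= -rmorphB/= -ratr_norm.
  by apply: lt_trans qe; rewrite ltr_rat.
- move=> e e0.
  have /Iy[c [Ic yc]] : nbhs (y : initial_topology (ratr : rat -> R))
      (ratr @^-1` ball (ratr y : R) (ratr e)).
    apply: (@initial_continuous _ _ (ratr : rat -> R)).
    by apply: nbhsx_ballx; rewrite ltr0q.
  by exists c => //; move: yc; rewrite /ball/= -rmorphB/= -ratr_norm ltr_rat.
Qed.

Lemma maximal_interval_nclosedP (R : realType) (X : set rat) (a : rat) :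
  ~ X a ->
  ~ closed_in_rat R [set b | same_interval (~` X) a b] <->
  exists y, adjacent X a y.
Proof.
move=> Xa; rewrite closed_in_ratP; split=> [|[y [Xy ady]] clI]; last first.
  have : same_interval (~` X) a y.
    apply: clI => e e0.
    have [ay|ya|ay] := ltgtP a y; last by rewrite ay in Xa.
    (* This point lies within [e] of [y] but short of it, and nothing in [X] separates it from
       [a]. *)
    - exists (Num.max a (y - e / 2)); last first.
        by rewrite ltr_norml; have [?|?] := leP a (y - e / 2); lra.
      apply/same_intervalP => c; have [?|?] := leP a (y - e / 2) => hc Xc;
      have [] := ady _ Xc;
      by have [ca|ca|ca] := ltgtP c a; [| |by rewrite ca in Xc]; lra.
    - exists (Num.min a (y + e / 2)); last first.
        by rewrite ltr_norml; have [?|?] := leP a (y + e / 2); lra.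
      apply/same_intervalP => c; have [?|?] := leP a (y + e / 2) => hc Xc;
      have [] := ady _ Xc;
      by have [ca|ca|ca] := ltgtP c a; [| |by rewrite ca in Xc]; lra.
  by case=> _ /(_ Xy).
move=> /existsNP[y /not_implyP[Iy nIy]]; exists y.
(* Such a [z] would keep the whole interval of [a] at distance at least [|y - z|] from [y]. *)
have ady z : X z -> ~ (a < z < y) /\ ~ (y < z < a).
  move=> Xz; split=> hz.
  - have [|c /same_intervalP ac] := Iy (y - z); first lra.
    rewrite ltr_norml => yc.
    by apply: (ac z) => //; lra.
  - have [|c /same_intervalP ac] := Iy (z - y); first lra.
    rewrite ltr_norml => yc.
    by apply: (ac z) => //; lra.
(* If [y] were outside [X], the closed segment from [a] to [y] would avoid [X], putting [y] in the
   interval. *)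
split=> //; apply: contrapT => nXy; apply: nIy.
apply/same_intervalP => c hc Xc; have [n1 n2] := ady _ Xc.
have [ca|ca|ca] := ltgtP c a; [| |by rewrite ca in Xc];
have [cy|cy|cy] := ltgtP c y; try (by rewrite cy in Xc); lra.
Qed.

Theorem theorem2 (R : realType) (X : set rat) :
  (exists f : rat -> rat,
     [/\ {homo f : u v / u <= v}, idempotent_fun f & range f = X]) <->
  (forall I : set rat, maximal_interval (~` X) I -> ~ closed_in_rat R I).
Proof.
split=> [[f [fmon fidem fX]] I [a nXa ->]|ncl].
  apply/maximal_interval_nclosedP => //; exists (f a); split.
    by rewrite -fX; exists a.
  move=> z; rewrite -fX => -[t _ ftz].
  have fz : f z = z by rewrite -ftz; exact: fidem.
  split=> /andP[].
  - by move=> /ltW/fmon; rewrite fz leNgt => /negP.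
  - by move=> + /ltW/fmon; rewrite fz ltNge => /negP.
(* The default [0] is never reached, by [ncl]. Since [xget] depends only on the set, points with
   equal adjacent sets get the same image. *)
pose f a := if `[<X a>] then a else xget 0 (adjacent X a).
have fid a : X a -> f a = a by move=> Xa; rewrite /f asboolT.
have fadj a : ~ X a -> adjacent X a (f a).
  move=> nXa; rewrite /f asboolF//; apply: xgetPex.
  by apply/(maximal_interval_nclosedP R nXa)/ncl; exists a.
have fXx a : X (f a).
  by have [Xa|/fadj[]//] := pselect (X a); rewrite fid.
exists f; split=> [a b ab|a|].
- have [sab|] := pselect (same_interval (~` X) a b).
    have [nXa nXb _] := sab; rewrite /f !asboolF//.
    rewrite (_ : adjacent X a = adjacent X b)//; apply/seteqP; split.
      exact: adjacent_same_interval.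
    exact/adjacent_same_interval/same_interval_sym.
  move=> /same_intervalP/existsNP[z /not_implyP[hz /contrapT Xz]].
  (* The separating point [z] of [X] bounds both images: neither [f a] nor [f b] can jump across
     it. *)
  apply: (@le_trans _ _ z).
  + have [Xa|nXa] := pselect (X a); first by rewrite fid//; lra.
    have [_ /(_ _ Xz)[n1 _]] := fadj _ nXa.
    by have [?|?|za] := ltgtP z a; [lra| |by rewrite za in Xz]; lra.
  + have [Xb|nXb] := pselect (X b); first by rewrite fid//; lra.
    have [_ /(_ _ Xz)[_ n2]] := fadj _ nXb.
    by have [?|?|zb] := ltgtP z b; [|lra|by rewrite zb in Xz]; lra.
- by rewrite /= fid.
- apply/seteqP; split=> [_ [a _ <-]//|x Xx].
  by exists x => //; rewrite fid.
Qed.
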